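(* In the Banach algebra $\ell^\infty$, the set of all topological divisors of zero and the set of all singular elements coincide.
   Context: $\ell^\infty$ denotes the Banach algebra of all bounded sequences of complex numbers, with coordinatewise operations and the supremum norm; its identity is the constant sequence $1=(1,1,\dots)$. An element $x$ of a Banach algebra $\mathcal{A}$ with identity is regular if there exists $y\in\mathcal{A}$ such that $xy=yx=1$, and singular if it is not regular. An element $z\in\mathcal{A}$ is called a topological divisor of zero if there exists a sequence $(z_n)_{n=1}^\infty$ in $\mathcal{A}$ such that $\|z_n\|=1$ for all $n\in\mathbb{N}$, and either $zz_n\to 0$ or $z_nz\to 0$ as $n\to\infty$. *)

(* Defs.v *)
From HB Require Import structures.
From mathcomp Require Import all_boot all_order all_algebra.
From mathcomp Require Import complex.
From mathcomp Require Import boolp classical_sets functions reals topology.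
From mathcomp Require Import normedtype.

Set Implicit Arguments.
Unset Strict Implicit.
Unset Printing Implicit Defensive.

Import Order.TTheory GRing.Theory Num.Theory.
Import numFieldNormedType.Exports.

Local Open Scope classical_set_scope.
Local Open Scope complex_scope.
Local Open Scope ring_scope.

(* Banach algebras with identity. The multiplication is not the one of a
   [GRing.Ring] structure because HB rejects a structure joining rings and
   normed modules that is declared after [Num.NumDomain]. *)
HB.mixin Record isBanachAlgebra (K : numFieldType) A
    & CompleteNormedModule K A := {
  bmul : A -> A -> A;
  bone : A;
  bmulA : associative bmul;
  bmul1x : left_id bone bmul;
  bmulx1 : right_id bone bmul;
  bmulDl : left_distributive bmul +%R;
  bmulDr : right_distributive bmul +%R;
  bscaleAl : forall (a : K) (x y : A), a *: bmul x y = bmul (a *: x) y;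
  bscaleAr : forall (a : K) (x y : A), a *: bmul x y = bmul x (a *: y);
  ler_norm_bmul : forall x y : A, `|bmul x y| <= `|x| * `|y|
}.

#[short(type="banachAlgType")]
HB.structure Definition BanachAlgebra (K : numFieldType) :=
  {A of CompleteNormedModule K A & isBanachAlgebra K A}.

Notation "x ** y" := (bmul x y) (at level 40, left associativity) : ring_scope.

Section BanachAlgebraElements.
Context {K : numFieldType} {A : banachAlgType K}.

Definition regular (x : A) := exists y : A, x ** y = bone /\ y ** x = bone.

Definition singular (x : A) := ~ regular x.

Definition topological_divisor_of_zero (z : A) :=
  exists u : nat -> A, (forall n, `|u n| = 1) /\
    ((z ** u n @[n --> \oo] --> 0) \/ (u n ** z @[n --> \oo] --> 0)).

End BanachAlgebraElements.

Section Linf.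
Variable R : realType.
Local Notation C := R[i].
Local Notation Re := (@complex.Re R).
Local Notation Im := (@complex.Im R).

Definition linf_pred : {pred nat -> C} :=
  fun u => `[< bounded_fun (u : nat -> C^o) >].

Lemma linf_predP (u : nat -> C) :
  reflect (exists M, forall n, `|u n| <= M) (u \in linf_pred).
Proof.
have PF := @globally_properfilter nat setT 0%N I.
apply: (iffP (asboolP _)) => [/ex_bound[M uM]|[M uM]].
  by exists M => n; exact: uM.
by apply/ex_bound; exists M => n _; exact: uM.
Qed.

Fact linf_subring_closed : subring_closed linf_pred.
Proof.
split.
- by apply/linf_predP; exists 1 => n; rewrite normr1.
- move=> u v /linf_predP[M uM] /linf_predP[N vN]; apply/linf_predP.
  by exists (M + N) => n; rewrite (le_trans (ler_normB _ _))// lerD.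
- move=> u v /linf_predP[M uM] /linf_predP[N vN]; apply/linf_predP.
  by exists (M * N) => n; rewrite normrM ler_pM.
Qed.

Fact linf_scaler_closed : scaler_closed linf_pred.
Proof.
move=> a u /linf_predP[M uM]; apply/linf_predP.
by exists (`|a| * M) => n; rewrite normrM ler_wpM2l.
Qed.

HB.instance Definition _ :=
  GRing.isSubringClosed.Build (nat -> C) linf_pred linf_subring_closed.
HB.instance Definition _ :=
  GRing.isScaleClosed.Build C (nat -> C) linf_pred linf_scaler_closed.

Record linf := Linf {
  linf_val :> nat -> C;
  linf_valP : linf_val \in linf_pred
}.

HB.instance Definition _ := [isSub for linf_val].
HB.instance Definition _ := [Choice of linf by <:].
HB.instance Definition _ := [SubChoice_isSubComNzRing of linf by <:].
HB.instance Definition _ := [SubZmodule_isSubLmodule of linf by <:].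

(* The supremum is taken in [R] and then injected into [C], since the norm of
   a [normedModType C] is [C]-valued. *)
Definition linf_norm (u : linf) : C :=
  (sup (range (fun n => Re `|u n|)))%:C.

Lemma normR_fineE (z : C) : (Re `|z|)%:C = `|z|.
Proof. by rewrite RRe_real// normr_real. Qed.

Lemma linf_has_sup (u : linf) : has_sup (range (fun n => Re `|u n|)).
Proof.
split; first by exists (Re `|u 0%N|), 0%N.
have /linf_predP[M uM] := linf_valP u.
exists (Re M) => _ [n _ <-]; have := uM n.
by rewrite lecE => /andP[].
Qed.

Lemma ler_linf_norm (u : linf) n : `|u n| <= linf_norm u.
Proof.
rewrite -normR_fineE /linf_norm lecR.
by apply: sup_upper_bound; [exact: linf_has_sup|exists n].
Qed.

Lemma linf_norm_ler (u : linf) (M : C) :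
  (forall n, `|u n| <= M) -> linf_norm u <= M.
Proof.
move=> uM; have M0 : 0 <= M by exact: le_trans (uM 0%N).
have -> : M = (Re M)%:C by rewrite RRe_real// ger0_real.
rewrite /linf_norm lecR; apply: ge_sup; first by exists (Re `|u 0%N|), 0%N.
by move=> _ [n _ <-]; have := uM n; rewrite lecE => /andP[].
Qed.

Fact linf_ler_normD (u v : linf) :
  linf_norm (u + v) <= linf_norm u + linf_norm v.
Proof.
apply: linf_norm_ler => n.
by rewrite (le_trans (ler_normD _ _))// lerD// ler_linf_norm.
Qed.

Fact linf_normrZ (a : C) (u : linf) : linf_norm (a *: u) = `|a| * linf_norm u.
Proof.
have le_normZ b v : linf_norm (b *: v) <= `|b| * linf_norm v.
  by apply: linf_norm_ler => n; rewrite normrM ler_wpM2l// ler_linf_norm.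
apply/le_anti; rewrite le_normZ/=.
have [->|a0] := eqVneq a 0.
  by rewrite normr0 mul0r (le_trans _ (ler_linf_norm _ 0%N)).
rewrite mulrC -ler_pdivlMr ?normr_gt0// mulrC -normfV.
by rewrite -{1}[u](scalerK a0) le_normZ.
Qed.

Fact linf_normr0_eq0 (u : linf) : linf_norm u = 0 -> u = 0.
Proof.
move=> u0; apply/val_inj/funext => n; apply/eqP.
by rewrite -normr_le0 -u0 ler_linf_norm.
Qed.

HB.instance Definition _ :=
  Lmodule_isNormed.Build C linf linf_ler_normD linf_normrZ linf_normr0_eq0.

Lemma linf_normE (u : linf) : `|u| = (sup (range (fun n => Re `|u n|)))%:C.
Proof. by []. Qed.

Fact linf_complete (F : set_system linf) :
  ProperFilter F -> cauchy F -> cvg F.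
Proof.
move=> FF Fc; apply/cvg_ex.
have Fball (e : C) : 0 < e -> exists2 x : linf, F (ball x e) &
    forall (y : linf) n, ball x e y -> `|x n - y n| < e.
  move=> e0; have /cauchyP/(_ e e0)[x xe] := Fc.
  exists x => // y n; rewrite -ball_normE /=; apply: le_lt_trans.
  exact: (ler_linf_norm (x - y) n).
pose coord (p : C -> R) n (u : linf) : R := p (u n).
have ccvg (p : C -> R) : (forall z, `|p z|%:C <= `|z|) ->
    (forall z w, p (z - w) = p z - p w) ->
    forall n, cvg (coord p n @ F).
  move=> pz pB n; apply: R_complete; apply/cauchyP => e e0.
  have [|x Fx xe] := Fball e%:C; first by rewrite ltcR.
  exists (coord p n x); rewrite /nbhs/=; apply: filterS Fx => y /(xe _ n) xye.
  rewrite /ball/= /coord -pB -ltcR; exact: le_lt_trans (pz _) xye.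
have ReP (z : C) : `|Re z|%:C <= `|z| by exact: normc_ge_Re.
have ImP (z : C) : `|Im z|%:C <= `|z|.
  by case: z => x y; simpc; rewrite -sqrtr_sqr ler_wsqrtr // lerDr sqr_ge0.
have le_ReIm (z : C) : `|z| <= (`|Re z| + `|Im z|)%:C.
  case: z => x y /=; rewrite normc_def lecR /=.
  rewrite -[leRHS]ger0_norm ?addr_ge0// -sqrtr_sqr ler_wsqrtr//.
  rewrite sqrrD !real_normK ?num_real// addrAC lerDl.
  by rewrite mulrn_wge0// mulr_ge0.
have ReB (z w : C) : Re (z - w) = Re z - Re w by case: z; case: w.
have ImB (z w : C) : Im (z - w) = Im z - Im w by case: z; case: w.
pose a : nat -> C := fun n =>
  lim (coord Re n @ F) +i* lim (coord Im n @ F).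
have near_a n (e : C) : 0 < e -> F [set y : linf | `|y n - a n| <= e].
  move=> e0; have eE : e = (Re e)%:C by rewrite RRe_real// gtr0_real.
  have e20 : 0 < Re e / 2 by rewrite divr_gt0// -ltcR -eE.
  have /cvgrPdist_le/(_ _ e20) Fre := ccvg _ ReP ReB n.
  have /cvgrPdist_le/(_ _ e20) Fim := ccvg _ ImP ImB n.
  apply: filterS2 Fre Fim => y yre yim.
  apply: (le_trans (le_ReIm _)); rewrite eE lecR [leRHS]splitr.
  by rewrite ReB ImB lerD// distrC.
have dist_a (e : C) : 0 < e -> exists2 x : linf, F (ball x e) &
    forall (y : linf) n, ball x e y -> `|y n - a n| <= e *+ 4.
  move=> e0; have [x Fx xe] := Fball _ e0; exists x => // y n /(xe _ n) yx.
  have [w [/(xe _ n) wx wa]] := filter_ex (filterI Fx (near_a n e e0)).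
  rewrite (_ : y n - a n = (y n - x n) + (x n - w n) + (w n - a n)); last first.
    by rewrite !subrKA.
  rewrite (le_trans (ler_normD _ _))// mulrS addrC lerD//.
  rewrite (le_trans (ler_normD _ _))// mulrS lerD//; first by rewrite distrC ltW.
  by rewrite (le_trans (ltW wx))// mulr2n lerDl ltW.
have a_bounded : a \in linf_pred.
  have [x Fx xa] := dist_a 1 ltr01.
  have /linf_predP[M xM] := linf_valP x; apply/linf_predP.
  exists (M + 1 *+ 4) => n; rewrite -[a n](subKr (x n)).
  rewrite (le_trans (ler_normB _ _))// lerD// xa//; exact: ballxx.
exists (Linf a_bounded); apply/cvgrPdist_le => e e0.
have e40 : 0 < e / 4 by rewrite divr_gt0.
have [x Fx xa] := dist_a _ e40.
apply: filterS Fx => y xy; apply: linf_norm_ler => n.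
by rewrite distrC (le_trans (xa y n xy))// -(mulr_natr (e / 4)) divfK ?pnatr_eq0.
Qed.

HB.instance Definition _ := Uniform_isComplete.Build linf linf_complete.

Fact linf_ler_normM (u v : linf) : `|u * v| <= `|u| * `|v|.
Proof.
apply: linf_norm_ler => n.
by rewrite normrM ler_pM//; exact: ler_linf_norm.
Qed.

Fact linf_scaleAl (a : C) (u v : linf) : a *: (u * v) = (a *: u) * v.
Proof. by apply/val_inj/funext => n; exact: mulrA. Qed.

Fact linf_scaleAr (a : C) (u v : linf) : a *: (u * v) = u * (a *: v).
Proof. by apply/val_inj/funext => n; exact: mulrCA. Qed.

HB.instance Definition _ := isBanachAlgebra.Build C linf
  (@mulrA linf) (@mul1r linf) (@mulr1 linf) (@mulrDl linf) (@mulrDr linf)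
  linf_scaleAl linf_scaleAr linf_ler_normM.

Lemma linf_addE (u v : linf) n : (u + v) n = u n + v n.
Proof. by []. Qed.

Lemma linf_scaleE (a : C) (u : linf) n : (a *: u) n = a * u n.
Proof. by []. Qed.

Lemma linf_bmulE (u v : linf) n : (u ** v) n = u n * v n.
Proof. by []. Qed.

Lemma linf_boneE n : (bone : linf) n = 1.
Proof. by []. Qed.

End Linf.

(* Main.v *)
Require Import Defs.
From mathcomp Require Import all_boot all_order all_algebra.
From mathcomp Require Import complex.
From mathcomp Require Import boolp.
From mathcomp Require Import classical_sets reals interval_inference.
From mathcomp Require Import topology normedtype.

(** In any Banach algebra a left inverse [y] of [z] gives
    [`|x| <= `|y| * `|z ** x|], and likewise on the other side, so
    multiplication by a regular [z] cannot shrink unit vectors to [0]: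
    topological divisors of zero are singular
    ([topological_divisor_of_zero_singular]).

    The converse is special to bounded sequences. A sequence whose terms stay
    away from [0] has a bounded pointwise inverse, so a singular [z] has terms
    of arbitrarily small modulus ([singular_linf_small_term]). Multiplying [z]
    by the [n]-th unit sequence leaves only the term [z n], so unit sequences
    placed where the terms of [z] are smaller and smaller witness that [z] is a
    topological divisor of zero ([singular_linf_topological_divisor_of_zero]). *)

Set Implicit Arguments.
Unset Strict Implicit.
Unset Printing Implicit Defensive.

Import Order.TTheory GRing.Theory Num.Theory.
Import numFieldNormedType.Exports.

Local Open Scope classical_set_scope.
Local Open Scope complex_scope.
Local Open Scope ring_scope.

Section BanachAlgebra.
Context {K : numFieldType} {A : banachAlgType K}.
Implicit Types x y z : A.

Lemma norm_le_left_inverse y z x : y ** z = bone -> `|x| <= `|y| * `|z ** x|.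
Proof. by move=> yz; rewrite -{1}[x]bmul1x -yz -bmulA ler_norm_bmul. Qed.

Lemma norm_le_right_inverse y z x : z ** y = bone -> `|x| <= `|y| * `|x ** z|.
Proof.
by move=> zy; rewrite -{1}[x]bmulx1 -zy bmulA mulrC ler_norm_bmul.
Qed.

Lemma cvg0_not_bounded_below (v : nat -> A) (c : K) :
  0 <= c -> (forall n, 1 <= c * `|v n|) -> ~ (v n @[n --> \oo] --> 0).
Proof.
move=> c0 cv /cvgr0Pnorm_lt v0.
(* The radius 1 / (c + 1) stays meaningful when c = 0. *)
have c1 : 0 < c + 1 by rewrite ltr_wpDl.
have c1V : 0 < (c + 1)^-1 by rewrite invr_gt0.
have [n vn] := filter_ex (v0 _ c1V).
have : c * `|v n| < 1.
  rewrite (@le_lt_trans _ _ (c * (c + 1)^-1))//.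
    by rewrite ler_wpM2l// ltW.
  by rewrite ltr_pdivrMr// mul1r ltrDl.
by move=> /(le_lt_trans (cv n)); rewrite ltxx.
Qed.

Lemma topological_divisor_of_zero_singular z :
  topological_divisor_of_zero z -> singular z.
Proof.
move=> [u [u1 zu]] [y [zy yz]].
case: zu; apply: (cvg0_not_bounded_below (normr_ge0 y)) => n; rewrite -(u1 n).
- exact: norm_le_left_inverse.
- exact: norm_le_right_inverse.
Qed.

End BanachAlgebra.

Section BoundedSequences.
Variable R : realType.
Local Notation C := R[i].
Implicit Types z : linf R.

Lemma regular_linf_bounded_below z (e : C) :
  0 < e -> (forall n, e <= `|z n|) -> regular z.
Proof.
move=> e0 ez.
have z0 n : z n != 0 by rewrite -normr_gt0 (lt_le_trans e0).
have zVb : (fun n => (z n)^-1) \in @linf_pred R.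
  apply/linf_predP; exists e^-1 => n.
  by rewrite normfV lef_pV2// posrE// (lt_le_trans e0).
exists (Linf zVb); split; apply/val_inj/funext => n.
- exact: (mulfV (z0 n)).
- exact: (mulVf (z0 n)).
Qed.

Lemma singular_linf_small_term z (e : C) :
  singular z -> 0 < e -> exists n, `|z n| < e.
Proof.
move=> zs e0; apply: contrapT => /forallNP ze; apply: zs.
apply: (regular_linf_bounded_below e0) => n.
(* The order of [C] is only partial, but moduli are real. *)
rewrite real_leNgt ?(gtr0_real e0) ?normr_real//.
by apply/negP; exact: ze.
Qed.

Lemma unit_seq_bounded (n : nat) :
  (fun m => (m == n)%:R : C) \in @linf_pred R.
Proof.
apply/linf_predP; exists 1 => m.
by case: (m == n); rewrite ?normr1 ?normr0.
Qed.

Definition unit_seq (n : nat) : linf R := Linf (unit_seq_bounded n).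

Lemma norm_unit_seq n : `|unit_seq n| = 1.
Proof.
apply/le_anti/andP; split.
  by apply: linf_norm_ler => m /=; case: (m == n); rewrite ?normr1 ?normr0.
by have := ler_linf_norm (unit_seq n) n; rewrite /= eqxx normr1.
Qed.

Lemma norm_bmul_unit_seq z n : `|z ** unit_seq n| <= `|z n|.
Proof.
apply: linf_norm_ler => m; rewrite linf_bmulE /=.
by case: eqP => [->|_]; rewrite ?mulr1 // mulr0 normr0.
Qed.

(** A positive complex number equals its real part, which reduces the claim to
    the archimedean property of the reals. *)
Lemma invn_lt_complex (e : C) : 0 < e -> \forall n \near \oo, n.+1%:R^-1 < e.
Proof.
move=> e0.
have eE : e = (complex.Re e)%:C by rewrite RRe_real// gtr0_real.
have Re0 : 0 < complex.Re e by rewrite -ltcR -eE.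
apply: filterS (near_infty_natSinv_lt (PosNum Re0)) => n /= ne.
by rewrite eE -[n.+1%:R](rmorph_nat (real_complex R)) -fmorphV /= ltcR.
Qed.

Lemma singular_linf_topological_divisor_of_zero z :
  singular z -> topological_divisor_of_zero z.
Proof.
move=> zs.
have invn_gt0 k : 0 < k.+1%:R^-1 :> C by rewrite invr_gt0 ltr0Sn.
have [s zsk] := choice (fun k => singular_linf_small_term zs (invn_gt0 k)).
exists (unit_seq \o s); split => [n|]; first exact: norm_unit_seq.
left; apply/cvgr0Pnorm_lt => e /invn_lt_complex; apply: filterS => k ke.
exact: le_lt_trans (norm_bmul_unit_seq z (s k)) (lt_trans (zsk k) ke).
Qed.

End BoundedSequences.

Theorem theorem3p3 (R : realType) :
  [set z : linf R | topological_divisor_of_zero z] =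
  [set z : linf R | singular z].
Proof.
apply/seteqP; split => z /=.
- exact: topological_divisor_of_zero_singular.
- exact: singular_linf_topological_divisor_of_zero.
Qed.
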